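(* Let $F:\mathbb{R}^n\to\mathbb{R}^n$ be a piecewise linear function in abs-normal form and let $x_*\in F^{-1}(0)$. Suppose that, with respect to some induced matrix norm, either $$\|I-J_\sigma^{-1}J_{\tilde\sigma}\|<1\quad\text{for all open }\sigma,\tilde\sigma,$$ or $$\|I-J_{\tilde\sigma}J_\sigma^{-1}\|<1\quad\text{for all open }\sigma,\tilde\sigma .$$ Then the full step Newton method $$x_+=x-J_\sigma^{-1}F(x),\qquad J_\sigma\in\partial^LF(x),$$ converges from every $x_0\in\mathbb{R}^n$ in finitely many steps to $x_*$. In either case the root is unique, i.e. $F^{-1}(0)=\{x_*\}$.
   Context: Abs-normal form: $z=c+Zx+L|z|$, $F(x)=b+Jx+Y|z|$, with $c\in\mathbb{R}^s$, $b\in\mathbb{R}^n$, $Z\in\mathbb{R}^{s\times n}$, $L\in\mathbb{R}^{s\times s}$ strictly lower triangular, $J\in\mathbb{R}^{n\times n}$, $Y\in\mathbb{R}^{n\times s}$, $|\cdot|$ componentwise; $z=z(x)$ is uniquely determined by $x$ through the first equation. For $\sigma\in\{-1,0,1\}^s$ let $P_\sigma=\{x\in\mathbb{R}^n:\mathrm{sign}(z(x))=\sigma\}$; $\sigma$ is called open if $P_\sigma$ is nonempty and open. For open $\sigma$, $J_\sigma=J+Y\Sigma(I-L\Sigma)^{-1}Z$ with $\Sigma=\mathrm{diag}(\sigma)$ is the Jacobian of $F$ on $P_\sigma$. The limiting Jacobian is the finite set $\partial^LF(x)=\{J_\sigma:\ x\in\overline{P_\sigma},\ \sigma\text{ open}\}$.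 In each Newton step an arbitrary element of $\partial^LF(x)$ at the current iterate $x$ may be chosen. The matrices $J_\sigma$ for open $\sigma$ are understood to be nonsingular, as required for the stated conditions to make sense. *)

(* Defs.v *)
From mathcomp Require Import all_boot all_order all_algebra.
From mathcomp Require Import all_classical all_reals all_analysis.

Set Implicit Arguments.
Unset Strict Implicit.
Unset Printing Implicit Defensive.

Import Order.TTheory GRing.Theory Num.Theory.
Import numFieldNormedType.Exports.

Local Open Scope classical_set_scope.
Local Open Scope ring_scope.

(* Data of  z = c + Z x + L |z|,  F x = b + J x + Y |z|. *)
Record abs_normal (R : realType) (n s : nat) := AbsNormal {
  an_c : 'cV[R]_s;
  an_b : 'cV[R]_n;
  an_Z : 'M[R]_(s, n);
  an_L : 'M[R]_s;
  an_J : 'M[R]_n;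
  an_Y : 'M[R]_(n, s);
  an_L_strict : forall i j : 'I_s, (i <= j)%N -> an_L i j = 0
}.

Section AbsNormalForm.
Variables (R : realType) (n s : nat).
Implicit Types (A : abs_normal R n s) (x : 'cV[R]_n).
Implicit Type sigma : 'cV[R]_s.

Definition abs_cv m (v : 'cV[R]_m) : 'cV[R]_m := map_mx Num.norm v.

Definition switching_rhs A x (z : 'cV[R]_s) : 'cV[R]_s :=
  an_c A + an_Z A *m x + an_L A *m abs_cv z.

(* The default value 0 of [xget] is never used: see [switching_vecP]. *)
Definition switching_vec A x : 'cV[R]_s :=
  xget 0 [set z | z = switching_rhs A x z].

Definition abs_fun A x : 'cV[R]_n :=
  an_b A + an_J A *m x + an_Y A *m abs_cv (switching_vec A x).

Definition sign_region A sigma : set 'cV[R]_n :=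
  [set x | map_mx Num.sg (switching_vec A x) = sigma].

Definition open_sign A sigma : Prop :=
  [/\ forall i, sigma i 0 \in [:: -1; 0; 1],
      sign_region A sigma !=set0 & open (sign_region A sigma)].

Definition sign_jacobian A sigma : 'M[R]_n :=
  let Sigma := diag_mx sigma^T in
  an_J A + an_Y A *m Sigma *m invmx (1%:M - an_L A *m Sigma) *m an_Z A.

Definition limiting_jacobian A x : set 'M[R]_n :=
  [set sign_jacobian A sigma | sigma in
    [set sigma | open_sign A sigma /\ closure (sign_region A sigma) x]].

Definition newton_run A (x : nat -> 'cV[R]_n) : Prop :=
  forall k, exists2 M, limiting_jacobian A (x k) M &
    x k.+1 = x k - invmx M *m abs_fun A (x k).

Lemma switching_rhs_eq A x (z1 z2 : 'cV[R]_s) (i : 'I_s) :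
  (forall j : 'I_s, (j < i)%N -> z1 j 0 = z2 j 0) ->
  switching_rhs A x z1 i 0 = switching_rhs A x z2 i 0.
Proof.
move=> eq_z; rewrite !mxE; congr (_ + _); apply: eq_bigr => j _.
have [ij|ji] := leqP i j; first by rewrite an_L_strict// !mul0r.
by rewrite !mxE eq_z.
Qed.

Lemma switching_vec_unique A x (z1 z2 : 'cV[R]_s) :
  z1 = switching_rhs A x z1 -> z2 = switching_rhs A x z2 -> z1 = z2.
Proof.
move=> e1 e2; apply/colP => i.
have [m] := ubnP (nat_of_ord i); elim: m i => // m IH i; rewrite ltnS => im.
rewrite e1 e2; apply: switching_rhs_eq => j ji; apply: IH.
exact: leq_trans im.
Qed.

Lemma switching_vecP A x : switching_vec A x = switching_rhs A x (switching_vec A x).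
Proof.
rewrite /switching_vec; case: xgetP => [z _ //|none].
pose it k := iter k (switching_rhs A x) 0.
have it_eq k (i : 'I_s) : (i < k)%N -> it k.+1 i 0 = it k i 0.
  elim: k i => // k IH i; rewrite ltnS => ik.
  apply: switching_rhs_eq => j ji; apply: IH.
  exact: leq_trans ik.
case: (none (it s)); apply/colP => i.
by rewrite -(it_eq s).
Qed.

End AbsNormalForm.

Section InducedNorm.
Variables (R : realType) (n : nat).

Definition is_vector_norm (N : 'cV[R]_n -> R) : Prop :=
  [/\ forall x, 0 <= N x,
      forall x, N x = 0 -> x = 0,
      forall (a : R) x, N (a *: x) = `|a| * N x &
      forall x y, N (x + y) <= N x + N y].

(* A real-valued [sup] is adequate: in finite dimension this set is nonempty
   and bounded for every norm [N]. *)
Definition induced_norm (N : 'cV[R]_n -> R) (M : 'M[R]_n) : R :=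
  sup [set N (M *m x) | x in [set x | N x <= 1]].

End InducedNorm.

(* Main.v *)
Require Import Defs.
From mathcomp Require Import all_boot all_order all_algebra.
From mathcomp Require Import all_classical all_reals all_analysis.
From mathcomp Require Import lra.
Import Order.TTheory GRing.Theory Num.Theory.
Import numFieldNormedType.Exports.
Local Open Scope classical_set_scope.
Local Open Scope ring_scope.

Set Implicit Arguments.
Unset Strict Implicit.
Unset Printing Implicit Defensive.

(** Each nonempty sign region is cut out by the signs of an affine map, so it
is either open or contained in a hyperplane. Finitely many hyperplanes cover no
nonempty open set, hence the closures of the open regions cover the whole space.
On such a closure [abs_fun A] is affine with slope [sign_jacobian A sigma]. As
there are finitely many regions, every closure that meets a small enough
neighbourhood of [x] contains [x]. This has two consequences. Near [x] the
increment from [x] to [y] is given by the Jacobian of a single open region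
([near_abs_fun_increment]), and a Newton step from a point close to the root
lands on the root at once ([near_root_newton_step]).

A map that around every point does not expand distances from that point by more
than a fixed factor has this factor as a global Lipschitz constant: go along the
segment between two points ([local_lipschitz_global]). So bounds on the finitely
many Jacobians become bounds on increments of [F := abs_fun A] between arbitrary
points. Let [rho < 1] be the largest of the induced norms in the hypothesis.

In the first case [x - J^-1 F x] is a [rho]-contraction for each open region
with Jacobian [J]; the root is a fixed point of it, so one Newton step
multiplies the distance [N (x - xs)] by at most [rho]. In the second case
[J x - F x] changes by at most [rho * N (J (y - x))] from [x] to [y]; for the
Newton step this reads [N (F y) <= rho * N (F x)], and with [y := xs] it bounds
[N (J (x - xs))] by a multiple of [N (F x)]. In both cases a merit function that
dominates the distance to [xs] decreases geometrically along every run. The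
iterates thus reach the neighbourhood from which one step hits [xs], and [xs] is
the only root because a root is a stationary point of the Newton step
([newton_converges_of_merit]). *)

(** * Norms on spaces of column vectors *)

Lemma line_continuous (R : realType) (V : normedModType R) (x v : V) :
  continuous (fun t : R => x + t *: v).
Proof.
move=> t; apply: cvgD; first exact: cvg_cst.
by apply: cvgZr_tmp; exact: cvg_id.
Qed.

Lemma le_mx_norm_entry (R : realType) (m n : nat) (M : 'M[R]_(m, n)) i j :
  `|M i j| <= `|M|.
Proof.
by rewrite [leRHS]/Num.Def.normr/= mx_normrE; apply: (le_bigmax _ _ (i, j)).
Qed.

(** [filterS] for the neighbourhoods of a matrix, with the filter instance made
explicit. *)
Lemma near_mx (R : realType) (m n : nat) (M : 'M[R]_(m, n))
    (P Q : set 'M[R]_(m, n)) :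
  P `<=` Q -> (\forall M' \near M, P M') -> \forall M' \near M, Q M'.
Proof. exact: (filterS (Filter := nbhs_filter M)). Qed.

Lemma nbhs_mx_dist_le (R : realType) (m n : nat) (M : 'M[R]_(m, n)) (e : R) :
  0 < e -> \forall M' \near M, `|M - M'| <= e.
Proof.
move=> e0; apply/nbhs_ballP; exists e => // M'.
by rewrite -ball_normE; exact: ltW.
Qed.

Lemma lipschitz_mx_continuous (R : realType) (m n : nat) (f : 'M[R]_(m, n) -> R)
    (C : R) :
  (forall x y, `|f x - f y| <= C * `|x - y|) -> continuous f.
Proof.
move=> fC x; apply/(@cvgrPdist_le _ _ _ _ (nbhs_filter x)) => e e0.
have C1 : 0 < `|C| + 1 by rewrite ltr_wpDl.
have r0 : 0 < (`|C| + 1)^-1 * e by rewrite mulr_gt0 ?invr_gt0.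
apply: near_mx (nbhs_mx_dist_le x r0) => y; rewrite ler_pdivlMl//.
apply: le_trans; apply: le_trans (fC x y) _.
by rewrite ler_wpM2r// (le_trans (ler_norm _))// lerDl.
Qed.

Lemma seminorm_le_mx_norm (R : realType) (n : nat) (p : 'cV[R]_n -> R) :
    (forall a x, p (a *: x) = `|a| * p x) ->
    (forall x y, p (x + y) <= p x + p y) ->
  exists2 C : R, 0 <= C & forall x, p x <= C * `|x|.
Proof.
move=> pZ pD.
have p0 : p 0 = 0 by rewrite -(scale0r 0) pZ normr0 mul0r.
have p_ge0 x : 0 <= p x.
  have := pD x (- x); rewrite subrr p0 -scaleN1r pZ normrN normr1 mul1r; lra.
exists (\sum_(i < n) p (delta_mx i 0)) => [|x]; first exact: sumr_ge0.
have {1}-> : x = \sum_(i < n) x i 0 *: delta_mx i 0.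
  apply/colP => k; rewrite summxE (bigD1 k)//= !mxE !eqxx mulr1 big1 ?addr0//.
  by move=> i ik; rewrite !mxE eq_sym (negbTE ik) mulr0.
apply: (@le_trans _ _ (\sum_(i < n) p (x i 0 *: delta_mx i 0))).
  elim/big_ind2 : _ => [|a b c d ab cd|//]; first by rewrite p0.
  exact: le_trans (pD _ _) (lerD ab cd).
rewrite mulr_suml; apply: ler_sum => i _.
by rewrite pZ mulrC ler_wpM2l// le_mx_norm_entry.
Qed.

Section VectorNorms.
Context {R : realType} {n : nat} (N : 'cV[R]_n -> R).
Hypothesis normN : is_vector_norm N.

Lemma vector_norm_ge0 x : 0 <= N x.
Proof. by case: normN. Qed.

Lemma vector_norm_eq0 x : N x = 0 -> x = 0.
Proof. by case: normN => _ + _ _; apply. Qed.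

Lemma vector_normZ (a : R) x : N (a *: x) = `|a| * N x.
Proof. by case: normN. Qed.

Lemma vector_normD x y : N (x + y) <= N x + N y.
Proof. by case: normN. Qed.

Lemma vector_norm0 : N 0 = 0.
Proof. by rewrite -(scale0r 0) vector_normZ normr0 mul0r. Qed.

Lemma vector_normN x : N (- x) = N x.
Proof. by rewrite -scaleN1r vector_normZ normrN normr1 mul1r. Qed.

Lemma vector_norm_continuous : continuous N.
Proof.
have [C _ NC] := seminorm_le_mx_norm vector_normZ vector_normD.
apply: (@lipschitz_mx_continuous _ _ _ _ C) => x y; apply: le_trans (NC _).
rewrite ler_norml; apply/andP; split.
  rewrite lerNl opprB lerBlDr -(vector_normN (x - y)) opprB.
  by rewrite (le_trans _ (vector_normD _ _))// subrK.
by rewrite lerBlDr (le_trans _ (vector_normD _ _))// subrK.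
Qed.

(** The nontrivial half of the equivalence of norms: [N] attains a positive
minimum on the compact unit sphere of the sup norm. The transpositions lead
to row vectors, where [bounded_closed_compact] applies. *)
Lemma mx_norm_le_vector_norm : exists2 c : R, 0 < c & forall x, c * `|x| <= N x.
Proof.
pose S := [set v : 'rV[R]_n | `|v| = 1].
have norm_tr (v : 'rV[R]_n) : `|v^T| = `|v|.
  apply/eqP; rewrite eq_le; apply/andP; split.
    rewrite [leLHS]/Num.Def.normr/= mx_normrE bigmax_le// => -[i j] _ /=.
    by rewrite mxE le_mx_norm_entry.
  rewrite [leLHS]/Num.Def.normr/= mx_normrE bigmax_le// => -[i j] _ /=.
  by have := @le_mx_norm_entry _ _ _ v^T j i; rewrite mxE.
have normalize (x : 'cV[R]_n) : x != 0 -> S (`|x|^-1 *: x)^T.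
  move=> x0; rewrite /S/= -norm_tr trmxK normrZ normfV normr_id mulVf//.
  by rewrite normr_eq0.
(* The sphere is empty exactly in dimension 0. *)
have [S0|] := pselect (S !=set0); last first.
  move=> S0; exists 1 => // x; have [->|/normalize Sx] := eqVneq x 0.
    by rewrite normr0 mulr0 vector_norm0.
  by case: S0; eexists; exact: Sx.
have cN : continuous (fun v : 'rV[R]_n => N v^T).
  move=> v; apply: continuous_comp; last exact: vector_norm_continuous.
  apply/(@cvgrPdist_le _ _ _ _ (nbhs_filter v)) => e e0.
  apply: near_mx (nbhs_mx_dist_le v e0) => w.
  by rewrite -linearB/= norm_tr.
have cS : compact S.
  apply: bounded_closed_compact.
    exists 1; split => // M M1 v /= ->; exact: ltW.
  have -> : S = (fun v : 'rV[R]_n => `|v|) @^-1` [set 1] by [].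
  by apply: closed_comp => [v _|]; [exact: norm_continuous|exact: closed_eq].
have [] := EVT_min_rV S0 cS (continuous_subspaceT cN).
move=> c /set_mem Sc cmin; exists (N c^T).
  rewrite lt_neqAle vector_norm_ge0 andbT eq_sym; apply/eqP => /vector_norm_eq0.
  move=> /(congr1 (fun M : 'cV[R]_n => `|M|)); rewrite norm_tr Sc normr0.
  by apply/eqP; rewrite oner_eq0.
move=> x; have [->|x0] := eqVneq x 0.
  by rewrite normr0 mulr0 vector_norm0.
have := cmin _ (mem_set (normalize _ x0)); rewrite trmxK vector_normZ.
by rewrite normfV normr_id ler_pdivlMl ?normr_gt0// mulrC.
Qed.

(** The supremum that defines the induced norm is over a bounded set, by the
equivalence of norms; hence it is an upper bound. *)
Lemma le_induced_norm (M : 'M[R]_n) x : N (M *m x) <= induced_norm N M * N x.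
Proof.
have [C C0 MC] : exists2 C : R, 0 <= C & forall x, N (M *m x) <= C * `|x|.
  apply: (@seminorm_le_mx_norm _ _ (fun x => N (M *m x))) => [a y|y z].
    by rewrite -scalemxAr vector_normZ.
  by rewrite mulmxDr vector_normD.
have [c c0 cN] := mx_norm_le_vector_norm.
have ubM : has_ubound [set N (M *m x) | x in [set x | N x <= 1]].
  exists (C / c) => _ [y /= Ny <-]; apply: le_trans (MC y) _.
  by rewrite ler_wpM2l// -[c^-1]mulr1 ler_pdivlMl// (le_trans (cN y)).
have [->|x0] := eqVneq x 0; first by rewrite mulmx0 vector_norm0 mulr0.
have Nx0 : 0 < N x.
  rewrite lt_neqAle vector_norm_ge0 andbT eq_sym.
  by apply: contra_neq x0; exact: vector_norm_eq0.
rewrite -ler_pdivrMr//; apply: (ub_le_sup ubM).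
exists ((N x)^-1 *: x) => /=.
  by rewrite vector_normZ ger0_norm ?invr_ge0 ?(ltW Nx0)// mulVf ?gt_eqF.
by rewrite -scalemxAr vector_normZ ger0_norm ?invr_ge0 ?(ltW Nx0)// mulrC.
Qed.

(** * From local to global Lipschitz bounds *)

(** Let [t] be the supremum of the times at which the bound from time 0 holds.
Chaining with a local bound around [t] shows that it holds at [t], and also a
little later unless [t] is 1. *)
Lemma local_lipschitz_unit_interval (g : R -> 'cV[R]_n) (q : R) :
    (forall t, \forall u \near t, N (g u - g t) <= `|u - t| * q) ->
  N (g 1 - g 0) <= q.
Proof.
move=> gq.
pose S := [set t | 0 <= t <= 1 /\ N (g t - g 0) <= t * q].
have S0 : S 0 by split; rewrite ?lexx ?ler01// subrr vector_norm0 mul0r.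
have ubS : has_ubound S by exists 1 => t [/andP[]].
have supS : has_sup S by split=> //; exists 0.
pose t := sup S.
have t0 : 0 <= t by exact: ub_le_sup.
have t1 : t <= 1 by apply: ge_sup => [|u [/andP[]]//]; exists 0.
have step u v : S u -> u <= v <= 1 -> N (g v - g u) <= (v - u) * q -> S v.
  move=> [/andP[u0 u1] Nu] /andP[uv v1] Nuv; split.
    by rewrite v1 (le_trans u0).
  have := vector_normD (g v - g u) (g u - g 0); rewrite subrKA.
  move: Nu Nuv; lra.
have /nbhs_ballP[e /= e0 te] := gq t.
have St : S t.
  have [u Su tu] := sup_adherent e0 supS.
  have ut : u <= t by exact: ub_le_sup.
  apply: (step u t Su); first by rewrite ut.
  have /te /= : ball t e u.
    by rewrite -ball_normE /ball_/= ger0_norm ?subr_ge0// ltrBlDr -ltrBlDl.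
  by rewrite -vector_normN opprB distrC ger0_norm ?subr_ge0.
have [t1E|t_neq1] := eqVneq t 1.
  by case: St; rewrite t1E mul1r.
have {}t1 : t < 1 by rewrite lt_neqAle t_neq1.
pose u := Num.min 1 (t + e / 2).
have tu : t < u by rewrite lt_min t1 ltrDl divr_gt0.
have : S u.
  apply: (step t u St); first by rewrite ltW//= ge_min lexx.
  have /te /= : ball t e u.
    rewrite -ball_normE /ball_/= distrC gtr0_norm ?subr_gt0// ltrBlDl.
    by rewrite gt_min ltrD2l gtr_pMr// invf_lt1// ltr1n orbT.
  by rewrite gtr0_norm ?subr_gt0.
by move=> /(ub_le_sup ubS); rewrite leNgt tu.
Qed.

(** The local bound is one-sided, as one end of the increment is the fixed point
[x]; this is all that a piecewise affine map gives, since two points near [x]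
need not lie in a common piece. *)
Lemma local_lipschitz_global (f : 'cV[R]_n -> 'cV[R]_n) (p : 'cV[R]_n -> R) :
    (forall a x, p (a *: x) = `|a| * p x) ->
    (forall x, \forall y \near x, N (f y - f x) <= p (y - x)) ->
  forall x y, N (f y - f x) <= p (y - x).
Proof.
move=> pZ fp x y.
pose seg (t : R) : 'cV[R]_n := x + t *: (y - x).
have seg_cont : continuous seg by exact: line_continuous.
have := @local_lipschitz_unit_interval (f \o seg) (p (y - x)).
rewrite /= /seg scale1r scale0r addr0 subrKC; apply => t.
apply: (filterS (Filter := nbhs_filter t)) (seg_cont t _ (fp (seg t))) => u /=.
by rewrite /seg opprD addrACA subrr add0r -scalerBl pZ.
Qed.

End VectorNorms.

(** * Finite covers by open and nowhere dense sets *)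

Section FiniteFamilies.
Context {T : topologicalType}.

(** Removing a closed nowhere dense set from a nonempty open set leaves a
nonempty open set. *)
Lemma open_avoid_nowhere_dense (I : eqType) (H : I -> set T) (r : seq I)
    (U : set T) :
    (forall i, i \in r -> closed (H i) /\ (H i)^° = set0) ->
  open U -> U !=set0 -> exists2 y, U y & forall i, i \in r -> ~ H i y.
Proof.
elim: r U => [|i r IHr] U Hr oU [x Ux]; first by exists x.
have [cHi Hi0] := Hr i (mem_head _ _).
have [|||y [Uy nHiy] nHry] := IHr (U `&` ~` H i).
- by move=> k kr; apply: Hr; rewrite in_cons kr orbT.
- by apply: openI => //; exact: closed_openC.
- apply: contrapT => noy; suff : (H i)^° x by rewrite Hi0.
  have : U `<=` H i.
    by move=> y Uy; apply: contrapT => nHiy; apply: noy; exists y.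
  by rewrite (open_subsetE _ oU); apply.
- by exists y => // k; rewrite in_cons => /predU1P[->//|/nHry].
Qed.

(** Otherwise a neighbourhood of [x] avoids all open members, so it would be
covered by finitely many closed nowhere dense sets. *)
Lemma open_members_closure_cover (I : finType) (P : I -> set T) :
    (forall x, exists i, P i x) ->
    (forall i, open (P i) \/
       exists H : set T, [/\ closed H, H^° = set0 & P i `<=` H]) ->
  forall x, exists2 i, open (P i) & closure (P i) x.
Proof.
move=> cover dich x; apply: contrapT => noi.
have : \forall y \near x, forall i, open (P i) -> ~ P i y.
  apply: filter_forall => i.
  have [oPi|nPi] := pselect (open (P i)); last by apply: nearW.
  have : ~ closure (P i) x by move=> cPix; apply: noi; exists i.
  move=> /existsNP[B /not_implyP[xB PB]]; apply: filterS xB => y By _ Py.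
  by apply: PB; exists y.
rewrite /prop_near1 nbhsE => -[U [oU Ux] avoid].
have /choice[H HP] : forall i, exists H : set T,
    ~ open (P i) -> [/\ closed H, H^° = set0 & P i `<=` H].
  move=> i; have [oPi|[H HP]] := dich i; last by exists H.
  by exists set0.
have := @open_avoid_nowhere_dense _ H [seq i <- enum I | `[< ~ open (P i) >]] U.
case=> // [i||y Uy nHy].
- by rewrite mem_filter => /andP[/asboolP/HP[]].
- by exists x.
have [i Piy] := cover y; have [oPi|noPi] := pselect (open (P i)).
  exact: avoid Uy i oPi Piy.
apply: (nHy i); first by rewrite mem_filter mem_enum andbT; apply/asboolP.
by have [_ _] := HP i noPi; exact.
Qed.

Lemma near_closure_finite (I : finType) (P : I -> set T) (x : T) :
  \forall y \near x, forall i, closure (P i) y -> closure (P i) x.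
Proof.
apply: filter_forall => i; have [cx|ncx] := pselect (closure (P i) x).
  exact: nearW.
have ocC := closed_openC (@closed_closure _ (P i)).
by apply: filterS (open_nbhs_nbhs (conj ocC ncx)).
Qed.

End FiniteFamilies.

(** * Sign regions of affine maps *)

Section AffineMaps.
Context {R : realType} {n s : nat}.
Implicit Types (B : 'M[R]_(s, n)) (d : 'cV[R]_s) (x : 'cV[R]_n).

Lemma affine_entry_continuous B d i :
  continuous (fun x : 'cV[R]_n => (d + B *m x) i 0).
Proof.
have [a y|y z|C C0 BC] :=
    @seminorm_le_mx_norm R n (fun x => `|(B *m x) i 0|).
- by rewrite -scalemxAr mxE normrM.
- by rewrite mulmxDr mxE ler_normD.
apply: (@lipschitz_mx_continuous _ _ _ _ C) => x y; apply: le_trans (BC _).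
by rewrite mulmxBr !mxE opprD addrACA subrr add0r.
Qed.

Lemma affine_zeros_closed B d i :
  closed [set x : 'cV[R]_n | (d + B *m x) i 0 = 0].
Proof.
apply: (@closed_comp _ _ (fun x : 'cV[R]_n => (d + B *m x) i 0) [set 0]).
  by move=> x _; exact: affine_entry_continuous.
exact: closed_eq.
Qed.

(** Along the [j]-th coordinate direction the entry [i] is a nonconstant affine
function of one variable, which vanishes at one point only. *)
Lemma affine_zeros_nowhere_dense B d i j :
  B i j != 0 -> [set x : 'cV[R]_n | (d + B *m x) i 0 = 0]^° = set0.
Proof.
move=> Bij; rewrite -subset0 => x Hx.
have := @line_continuous R _ x (delta_mx j 0) 0.
rewrite /continuous_at scale0r addr0 => /(_ _ Hx).
move=> /nbhs_ballP[e /= e0 zero].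
have /zero /= : ball 0 e (e / 2).
  rewrite -ball_normE /ball_/= sub0r normrN gtr0_norm ?divr_gt0//.
  by rewrite gtr_pMr// invf_lt1// ltr1n.
have /= x0 := nbhs_singleton Hx.
rewrite mulmxDr addrA mxE x0 add0r -scalemxAr mxE -colE mxE => /eqP.
by rewrite !mulf_eq0 (negbTE Bij) orbF gt_eqF// invr_eq0 pnatr_eq0.
Qed.

Lemma near_sgr (f : 'cV[R]_n -> R) x : continuous f -> f x != 0 ->
  \forall y \near x, Num.sg (f y) = Num.sg (f x).
Proof.
move=> fc fx; case: (ltgtP (f x) 0) => [fx0|fx0|fx0].
- by apply: near_mx (cvgr_lt (f x) (fc x) 0 fx0) => y fy0; rewrite !ltr0_sg.
- by apply: near_mx (cvgr_gt (f x) (fc x) 0 fx0) => y fy0; rewrite !gtr0_sg.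
- by rewrite fx0 eqxx in fx.
Qed.

(** A vanishing sign of a nonconstant entry confines the region to a hyperplane.
If there is none, the entries of sign 0 are constant and the other ones keep
their sign under small perturbations. *)
Lemma affine_sign_region_dichotomy B d (sigma : 'cV[R]_s) :
  let S := [set x | map_mx Num.sg (d + B *m x) = sigma] in
  open S \/ exists H : set 'cV[R]_n, [/\ closed H, H^° = set0 & S `<=` H].
Proof.
move=> S.
have [[i [j [si Bij]]]|nH] :=
    pselect (exists i j, sigma i 0 = 0 /\ B i j != 0).
  right; exists [set x | (d + B *m x) i 0 = 0]; split.
  - exact: affine_zeros_closed.
  - exact: affine_zeros_nowhere_dense Bij.
  - move=> x /= /colP/(_ i); rewrite mxE si => /eqP.
    by rewrite sgr_eq0 => /eqP.
left; rewrite openE => x Sx; rewrite /interior.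
have : \forall y \near x, forall i,
    Num.sg ((d + B *m y) i 0) = Num.sg ((d + B *m x) i 0).
  apply: (filter_forall (nbhs_filter x)) => i.
  have [si|si] := eqVneq (sigma i 0) 0.
    apply: (nearW (nbhs_filter x)) => y; congr Num.sg; rewrite !mxE.
    congr (_ + _); apply: eq_bigr => j _.
    have [->|Bij] := eqVneq (B i j) 0; first by rewrite !mul0r.
    by case: nH; exists i, j.
  apply: near_sgr; first exact: affine_entry_continuous.
  by rewrite -sgr_eq0; have /colP/(_ i) := Sx; rewrite mxE => ->.
apply: near_mx => y Sy; rewrite /S/= -Sx; apply/colP => i.
by rewrite [LHS]mxE [RHS]mxE.
Qed.

End AffineMaps.

(** * The abs-normal form on the closure of a sign region *)

Section SignRegions.
Context {R : realType} {n s : nat} (A : abs_normal R n s).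
Implicit Types (x y : 'cV[R]_n) (sigma z : 'cV[R]_s).

Definition sign_mx sigma : 'M[R]_s := diag_mx sigma^T.

(** With [|z|] replaced by [Sigma z] the switching equation is the linear system
[(I - L Sigma) z = c + Z x]; its solution is [affine_switching]. *)
Definition switching_const sigma : 'cV[R]_s :=
  invmx (1%:M - an_L A *m sign_mx sigma) *m an_c A.

Definition switching_slope sigma : 'M[R]_(s, n) :=
  invmx (1%:M - an_L A *m sign_mx sigma) *m an_Z A.

Definition affine_switching sigma x : 'cV[R]_s :=
  switching_const sigma + switching_slope sigma *m x.

Lemma sign_mx_mulE sigma z i : (sign_mx sigma *m z) i 0 = sigma i 0 * z i 0.
Proof. by rewrite mul_diag_mx !mxE. Qed.

(** [L Sigma] is strictly lower triangular, as [L] is. *)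
Lemma switching_system_unit sigma : 1%:M - an_L A *m sign_mx sigma \in unitmx.
Proof.
have entry (i j : 'I_s) : (i <= j)%N -> (an_L A *m sign_mx sigma) i j = 0.
  by move=> ij; rewrite mul_mx_diag mxE an_L_strict// mul0r.
set M := an_L A *m _ in entry *; rewrite unitmxE det_trig.
  rewrite big1 ?unitr1// => i _; rewrite mxE [X in _ + X]mxE entry// mxE eqxx.
  by rewrite subr0.
apply/is_trig_mxP => i j ij; rewrite mxE [X in _ + X]mxE entry 1?ltnW// mxE.
by rewrite subr0 -val_eqE/= ltn_eqF.
Qed.

Lemma switching_rhs_affine sigma x z : abs_cv z = sign_mx sigma *m z ->
  z = switching_rhs A x z <-> z = affine_switching sigma x.
Proof.
move=> absz; rewrite /switching_rhs absz.
have U := switching_system_unit sigma.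
have -> : affine_switching sigma x =
    invmx (1%:M - an_L A *m sign_mx sigma) *m (an_c A + an_Z A *m x).
  by rewrite mulmxDr mulmxA.
rewrite mulmxA; split => [/eqP zE|->].
  rewrite -[LHS](mulKmx U); congr (_ *m _).
  by rewrite mulmxBl mul1mx; apply/eqP; rewrite subr_eq.
apply/eqP; rewrite -subr_eq; apply/eqP.
set w := invmx _ *m _; rewrite -{1}[w]mul1mx -mulmxBl.
exact: mulKVmx.
Qed.

Lemma abs_cv_sign z : abs_cv z = sign_mx (map_mx Num.sg z) *m z.
Proof.
by apply/colP => i; rewrite sign_mx_mulE !mxE normrEsg.
Qed.

Lemma switching_vec_affine sigma x :
    abs_cv (affine_switching sigma x) =
      sign_mx sigma *m affine_switching sigma x ->
  switching_vec A x = affine_switching sigma x.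
Proof.
move=> absz; apply: (@switching_vec_unique _ _ _ A x).
  exact: switching_vecP.
exact/(switching_rhs_affine _ absz).
Qed.

Lemma sign_regionE sigma :
  sign_region A sigma =
    [set x | map_mx Num.sg (affine_switching sigma x) = sigma].
Proof.
apply/seteqP; split => x /= sx.
  rewrite -[RHS]sx; congr (map_mx _ _); apply/esym/switching_rhs_affine.
    by rewrite -{1}sx; exact: abs_cv_sign.
  exact: switching_vecP.
rewrite /sign_region /= (@switching_vec_affine sigma)//.
by rewrite abs_cv_sign sx.
Qed.

Lemma sign_region_dichotomy sigma :
  open (sign_region A sigma) \/ exists H : set 'cV[R]_n,
    [/\ closed H, H^° = set0 & sign_region A sigma `<=` H].
Proof. by rewrite sign_regionE; exact: affine_sign_region_dichotomy. Qed.

(** The condition [|z| = Sigma z] on the affine solution [z] is closed, so it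
passes from the region to its closure, where it still forces [z] to be the
switching vector. *)
Lemma switching_vec_closure sigma x : closure (sign_region A sigma) x ->
  switching_vec A x = affine_switching sigma x /\
  abs_cv (switching_vec A x) = sign_mx sigma *m switching_vec A x.
Proof.
move=> cx; suff absz : abs_cv (affine_switching sigma x) =
    sign_mx sigma *m affine_switching sigma x.
  by rewrite (switching_vec_affine absz).
apply/colP => i; rewrite sign_mx_mulE [LHS]mxE.
pose h (t : R) := `|t| - sigma i 0 * t.
pose E := [set y | h (affine_switching sigma y i 0) = 0].
have closedE : closed E.
  apply: (@closed_comp _ _ (fun y : 'cV[R]_n => affine_switching sigma y i 0)
      (h @^-1` [set 0])).
    by move=> y _; exact: affine_entry_continuous.
  apply: closed_comp; last exact: closed_eq.
  move=> t _; apply: cvgB; first by apply: cvg_norm; exact: cvg_id.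
  exact: mulrl_continuous.
suff /eqP : E x by rewrite subr_eq0 => /eqP.
rewrite ((closure_id E).1 closedE); apply: closureS cx => y.
rewrite sign_regionE /E/= /h => /colP/(_ i).
by rewrite [LHS]mxE => <-; rewrite normrEsg subrr.
Qed.

Lemma abs_fun_affine sigma x y :
    closure (sign_region A sigma) x -> closure (sign_region A sigma) y ->
  abs_fun A y - abs_fun A x = sign_jacobian A sigma *m (y - x).
Proof.
move=> /switching_vec_closure[zx absx] /switching_vec_closure[zy absy].
have dz : switching_vec A y - switching_vec A x =
    switching_slope sigma *m (y - x).
  by rewrite zx zy /affine_switching mulmxBr opprD addrACA subrr add0r.
have -> : sign_jacobian A sigma =
    an_J A + an_Y A *m (sign_mx sigma *m switching_slope sigma).
  by rewrite /sign_jacobian /switching_slope !mulmxA.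
rewrite mulmxDl -2!mulmxA -dz /abs_fun absx absy !mulmxBr.
by rewrite opprD addrACA (opprD (an_b A)) (addrACA (an_b A)) subrr add0r.
Qed.

End SignRegions.

(** * Newton's method near the root and along a merit function *)

Section Newton.
Context {R : realType} {n s : nat} (A : abs_normal R n s).
Implicit Types (x y : 'cV[R]_n) (sigma tau : 'cV[R]_s).

(** An enumeration of all sign vectors by a finite type, with repetitions:
[(true, true)] and [(false, false)] both encode the sign 0. *)
Definition sign_of_code (f : {ffun 'I_s -> bool * bool}) : 'cV[R]_s :=
  \col_i ((f i).1%:R - (f i).2%:R).

Lemma sign_of_code_surj sigma :
  (forall i, sigma i 0 \in [:: -1; 0; 1]) -> exists f, sigma = sign_of_code f.
Proof.
move=> sigmaP; exists [ffun i => (0 < sigma i 0, sigma i 0 < 0)].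
apply/colP => i; rewrite mxE ffunE/=; have := sigmaP i; rewrite !inE.
case/or3P => /eqP->.
- by rewrite ltr0N1 ltrN10 sub0r.
- by rewrite ltxx subrr.
- by rewrite ltr01 ltr10 subr0.
Qed.

Lemma sign_of_code_values f i : sign_of_code f i 0 \in [:: -1; 0; 1].
Proof.
rewrite mxE !inE; case: (f i) => -[] [] /=.
- by rewrite subrr eqxx orbT.
- by rewrite subr0 eqxx !orbT.
- by rewrite sub0r eqxx.
- by rewrite subrr eqxx orbT.
Qed.

Lemma sgr_values (m : nat) (z : 'cV[R]_m) i :
  map_mx Num.sg z i 0 \in [:: -1; 0; 1].
Proof. by rewrite mxE !inE; case: sgrP; rewrite eqxx ?orbT. Qed.

Lemma limiting_jacobian_nonempty x : limiting_jacobian A x !=set0.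
Proof.
have [y|f|f openf xf] := @open_members_closure_cover _ _
    (fun f => sign_region A (sign_of_code f)) _ _ x.
- have [f fE] := sign_of_code_surj (sgr_values (switching_vec A y)).
  by exists f; rewrite /sign_region /= fE.
- exact: sign_region_dichotomy.
exists (sign_jacobian A (sign_of_code f)); exists (sign_of_code f) => //.
split=> //; split => //; first exact: sign_of_code_values.
by have [y [Py _]] := xf setT (@filterT _ _ (nbhs_filter x)); exists y.
Qed.

Lemma near_open_sign_closure x : \forall y \near x, forall sigma,
  open_sign A sigma -> closure (sign_region A sigma) y ->
  closure (sign_region A sigma) x.
Proof.
have := @near_closure_finite _ _ (fun f => sign_region A (sign_of_code f)) x.
apply: near_mx => y closure_yx sigma [/sign_of_code_surj[f ->] _ _].
exact: closure_yx.
Qed.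

Lemma near_abs_fun_increment x : \forall y \near x, exists2 tau,
  open_sign A tau & abs_fun A y - abs_fun A x = sign_jacobian A tau *m (y - x).
Proof.
apply: near_mx (near_open_sign_closure x) => y closure_yx.
have [_ [tau [open_tau tau_y] _]] := limiting_jacobian_nonempty y.
by exists tau => //; apply: abs_fun_affine => //; exact: closure_yx.
Qed.

(** Close to the root [xs], every selectable region has [xs] in its closure, so
the linearisation at the current iterate is exact at [xs]. *)
Lemma near_root_newton_step xs : abs_fun A xs = 0 ->
    (forall sigma, open_sign A sigma -> sign_jacobian A sigma \in unitmx) ->
  \forall y \near xs, forall M, limiting_jacobian A y M ->
    y - invmx M *m abs_fun A y = xs.
Proof.
move=> root nonsing; apply: near_mx (near_open_sign_closure xs) => y closure_yx.
move=> _ [sigma [open_sigma sigma_y] <-].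
have := abs_fun_affine (closure_yx _ open_sigma sigma_y) sigma_y.
rewrite root subr0 => ->; rewrite mulKmx ?nonsing//.
by rewrite opprB subrKC.
Qed.

(** The merit [Q] of the [k]-th iterate is at most [rho ^+ k] times the initial
one, so some iterate comes close to [xs] and the next one is equal to [xs].
A root is stationary for the Newton step, hence has merit 0. *)
Lemma newton_converges_of_merit xs (Q : 'cV[R]_n -> R) (rho c : R) :
    abs_fun A xs = 0 ->
    (forall sigma, open_sign A sigma -> sign_jacobian A sigma \in unitmx) ->
    0 <= rho < 1 -> 0 < c ->
    (forall x M, limiting_jacobian A x M ->
       Q (x - invmx M *m abs_fun A x) <= rho * Q x) ->
    (forall x, c * `|x - xs| <= Q x) ->
  (forall x0 : 'cV[R]_n,
     (exists x : nat -> 'cV[R]_n, x 0%N = x0 /\ newton_run A x) /\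
     (forall x : nat -> 'cV[R]_n, x 0%N = x0 -> newton_run A x ->
        exists K : nat, forall k : nat, (K <= k)%N -> x k = xs)) /\
  [set x : 'cV[R]_n | abs_fun A x = 0] = [set xs].
Proof.
move=> root nonsing /andP[rho0 rho1] c0 Qstep Qdist.
have Q0 x : 0 <= Q x.
  by apply: le_trans (Qdist x); rewrite mulr_ge0// ltW.
split; last first.
  apply/seteqP; split => [x /= Fx|x -> //].
  have [M xM] := limiting_jacobian_nonempty x.
  have := Qstep x M xM; rewrite Fx mulmx0 subr0 => Qx.
  have {}Qx : Q x = 0 by have := Q0 x; nra.
  have := Qdist x; rewrite Qx pmulr_rle0// normr_le0 subr_eq0.
  by move/eqP.
move=> x0; split.
  have /choice[M MP] := limiting_jacobian_nonempty.
  pose x k := iter k (fun x => x - invmx (M x) *m abs_fun A x) x0.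
  by exists x; split=> // k; exists (M (x k)).
move=> x _ run.
have /nbhs_ballP[e /= e0 near_root] := near_root_newton_step root nonsing.
have land k : `|x k - xs| < e -> x k.+1 = xs.
  move=> xke; have [M xM ->] := run k; apply: near_root xM.
  by rewrite -ball_normE /ball_/= distrC.
have Qpow k : Q (x k) <= rho ^+ k * Q (x 0%N).
  elim: k => [|k IHk]; first by rewrite expr0 mul1r.
  have [M xM ->] := run k; apply: le_trans (Qstep _ _ xM) _.
  by rewrite exprS -mulrA ler_wpM2l.
have [K Ksmall] : exists K, rho ^+ K * Q (x 0%N) < c * e.
  have Q1 : 0 < Q (x 0%N) + 1 by rewrite ltr_wpDl.
  have rhoV : `|rho| < 1 by rewrite ger0_norm.
  have ce : 0 < c * e / (Q (x 0%N) + 1) by rewrite divr_gt0// mulr_gt0.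
  have /cvgr0Pnorm_lt/(_ _ ce)[K _ KP] := cvg_expr rhoV.
  exists K; have := KP K (leqnn K); rewrite ger0_norm ?exprn_ge0//.
  rewrite ltr_pdivlMr//; apply: le_lt_trans.
  by rewrite ler_wpM2l ?exprn_ge0// lerDl.
exists K.+1; elim=> // k IHk; rewrite ltnS leq_eqVlt => /predU1P[<-|Kk].
  apply: land; rewrite -(ltr_pM2l c0).
  exact: le_lt_trans (Qdist _) (le_lt_trans (Qpow K) Ksmall).
by apply: land; rewrite IHk// subrr normr0.
Qed.

End Newton.

(** * Contraction estimates from the Jacobians *)

Section Contraction.
Context {R : realType} {n s : nat} (A : abs_normal R n s).
Context (N : 'cV[R]_n -> R) (normN : is_vector_norm N).
Implicit Types (x y : 'cV[R]_n) (sigma tau : 'cV[R]_s).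

(** A finite family of numbers below 1 has a maximum below 1. *)
Lemma uniform_contraction (C : 'cV[R]_s -> 'cV[R]_s -> 'M[R]_n) :
    (forall sigma tau, open_sign A sigma -> open_sign A tau ->
       induced_norm N (C sigma tau) < 1) ->
  exists2 rho : R, 0 <= rho < 1 & forall sigma tau v,
    open_sign A sigma -> open_sign A tau -> N (C sigma tau *m v) <= rho * N v.
Proof.
move=> Clt1; pose g f : R :=
  let sigma := sign_of_code f.1 in let tau := sign_of_code f.2 in
  if `[< open_sign A sigma /\ open_sign A tau >]
  then induced_norm N (C sigma tau) else 0.
exists (\big[Num.max/0]_f g f).
  rewrite bigmax_ge_id/=; apply/bigmax_ltP; split=> // f _; rewrite /g.
  by case: asboolP => // -[]; exact: Clt1.
move=> sigma tau v osigma otau; apply: le_trans (le_induced_norm normN _ _) _.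
apply: ler_wpM2r; first exact: vector_norm_ge0.
have [[fs sigmaE] [ft tauE]] : (exists fs, sigma = sign_of_code fs) /\
    (exists ft, tau = sign_of_code ft).
  by split; apply: sign_of_code_surj; [case: osigma|case: otau].
have <- : g (fs, ft) = induced_norm N (C sigma tau).
  by rewrite /g /= -sigmaE -tauE asboolT.
exact: le_bigmax.
Qed.

(** Around each point the increments of [F := abs_fun A] are those of the
Jacobian of one open region, so the local bound is the hypothesis. For a
Jacobian [J] of an open region, one case of the theorem uses [P = M = 1]
and [B = J^-1], where [P x - B F x] is the Newton map of [J]; the
other one uses [P = M = J] and [B = 1], where it is the error of the
linearisation of [F] by [J]. *)
Lemma preconditioned_abs_fun_lipschitz (P B M : 'M[R]_n) (rho : R) :
    (forall tau v, open_sign A tau ->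
       N ((P - B *m sign_jacobian A tau) *m v) <= rho * N (M *m v)) ->
  forall x y, N ((P *m y - B *m abs_fun A y) - (P *m x - B *m abs_fun A x)) <=
              rho * N (M *m (y - x)).
Proof.
move=> Ptau; apply: (local_lipschitz_global normN
    (f := fun x => P *m x - B *m abs_fun A x)
    (p := fun v => rho * N (M *m v))) => [a v|x].
  by rewrite -scalemxAr vector_normZ// mulrCA.
apply: near_mx (near_abs_fun_increment A x) => y [tau otau Fyx].
rewrite opprD addrACA -opprD -!mulmxBr Fyx mulmxA -mulmxBl.
exact: Ptau.
Qed.

End Contraction.

Unset Implicit Arguments.

Theorem proposition5p1 (R : realType) (n s : nat) (A : abs_normal R n s)
    (xs : 'cV[R]_n) (root_xs : abs_fun A xs = 0)
    (nonsing : forall sigma, open_sign A sigma ->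
       sign_jacobian A sigma \in unitmx)
    (N : 'cV[R]_n -> R) (normN : is_vector_norm N)
    (contr :
      (forall sigma tau, open_sign A sigma -> open_sign A tau ->
         induced_norm N
           (1%:M - invmx (sign_jacobian A sigma) *m sign_jacobian A tau) < 1)
      \/
      (forall sigma tau, open_sign A sigma -> open_sign A tau ->
         induced_norm N
           (1%:M - sign_jacobian A tau *m invmx (sign_jacobian A sigma)) < 1)) :
  (forall x0 : 'cV[R]_n,
     (exists x : nat -> 'cV[R]_n, x 0%N = x0 /\ newton_run A x) /\
     (forall x : nat -> 'cV[R]_n, x 0%N = x0 -> newton_run A x ->
        exists K : nat, forall k : nat, (K <= k)%N -> x k = xs)) /\
  [set x : 'cV[R]_n | abs_fun A x = 0] = [set xs].
Proof.
(* First case: the merit function is the distance to the root. *)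
case: contr => /(uniform_contraction normN)[rho rho01 contr].
  have [c c0 cN] := mx_norm_le_vector_norm normN.
  apply: (newton_converges_of_merit (Q := fun x => N (x - xs)) root_xs nonsing
    rho01 c0) => // x _ [sigma [osigma _] <-].
  have := @preconditioned_abs_fun_lipschitz _ _ _ A _ normN
    1%:M (invmx (sign_jacobian A sigma)) 1%:M rho.
  move=> /(_ _ xs x); rewrite !mul1mx root_xs mulmx0 subr0 addrAC; apply.
  by move=> tau v otau; rewrite mul1mx; exact: contr.
(* Second case: the merit function is the norm of the residual [F x]. *)
have residual sigma x y : open_sign A sigma ->
    N ((sign_jacobian A sigma *m y - abs_fun A y) -
       (sign_jacobian A sigma *m x - abs_fun A x)) <=
    rho * N (sign_jacobian A sigma *m (y - x)).
  move=> osigma; have := @preconditioned_abs_fun_lipschitz _ _ _ A _ normN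
    (sign_jacobian A sigma) 1%:M (sign_jacobian A sigma) rho.
  move=> /(_ _ x y); rewrite !mul1mx; apply => tau v otau.
  (* [J - J_tau = (1 - J_tau J^-1) J] for the Jacobian [J] of [sigma]. *)
  rewrite mul1mx -[X in N (X *m _)](mulmxKV (nonsing _ osigma)) mulmxBl.
  rewrite mulmxV ?nonsing// -mulmxA.
  exact: contr.
have [_ [sigma [osigma _] _]] := limiting_jacobian_nonempty A xs.
set J := sign_jacobian A sigma.
have normNJ : is_vector_norm (fun v => N (J *m v)).
  split=> [v|v|a v|v w].
  - exact: vector_norm_ge0.
  - move=> /(vector_norm_eq0 normN) Jv; rewrite -(mulKmx (nonsing _ osigma) v).
    by rewrite -/J Jv mulmx0.
  - by rewrite -scalemxAr vector_normZ.
  - by rewrite mulmxDr vector_normD.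
have [c c0 cNJ] := mx_norm_le_vector_norm normNJ.
have /andP[rho0 rho1] := rho01.
apply: (newton_converges_of_merit (Q := fun x => N (abs_fun A x))
  (c := (1 - rho) * c) root_xs nonsing rho01) => [|x _ [tau [otau _] <-]|x].
- by rewrite mulr_gt0// subr_gt0.
- set y := x - _.
  have Jy : sign_jacobian A tau *m y = sign_jacobian A tau *m x - abs_fun A x.
    by rewrite mulmxBr mulKVmx ?nonsing.
  have := residual tau x y otau; move: y Jy => y Jy.
  rewrite mulmxBr Jy addrAC subrr add0r addrAC subrr add0r.
  by rewrite !vector_normN.
- rewrite -mulrA; apply: le_trans (_ : (1 - rho) * N (J *m (x - xs)) <= _).
    by rewrite ler_wpM2l// subr_ge0 ltW.
  have := residual sigma xs x osigma; rewrite -/J root_xs subr0.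
  rewrite addrAC -mulmxBr => le_res.
  have := vector_normD normN (J *m (x - xs) - abs_fun A x) (abs_fun A x).
  rewrite subrK; move: le_res; lra.
Qed.
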